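(* Let $\mathbb{F}$ be a field of characteristic zero. If $a(x) \in \mathbb{F}[[x]]$ is non-constant, $a(x) = a_0 + a_rx^r + a_{r+1}x^{r+1} + \cdots$ with $r > 0$ and $a_r \neq 0$, then $a(x)$ may be uniquely written as $$a(x) = a_0 + a_r\cdot\big(A(x)\big)^r$$ with $A(x)\in\mathbb{F}[[x]]$ of the form $A(x) = x + \cdots$ (zero constant term and coefficient of $x$ equal to $1$). Moreover, $A(x)$ has a compositional inverse $\overline{A}(x)$, which is also of the form $\overline{A}(x) = x + \cdots$.
   Context: $\mathbb{F}[[x]]$ is the ring of formal power series over $\mathbb{F}$. The compositional inverse of a series $A(x)$ with zero constant term and nonzero coefficient of $x$ is the series $\overline{A}(x)$ with $A(\overline{A}(x)) = \overline{A}(A(x)) = x$. *)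

(* Defs.v *)
From HB Require Import structures.
From mathcomp Require Import all_boot all_algebra.
From mathcomp Require Import boolp.

Set Implicit Arguments.
Unset Strict Implicit.
Unset Printing Implicit Defensive.

Import GRing.Theory.
Local Open Scope ring_scope.

(* Formal power series R[[x]]: [A n] is the coefficient of x^n in [A].  A record
   rather than a bare function type, so that the Cauchy product below does not
   compete with pointwise multiplication of functions. *)
Record fps (R : Type) := FPS { fps_coef :> nat -> R }.

Notation "{ 'fps' R }" := (fps R) (at level 0, format "{ 'fps'  R }")
  : type_scope.

Lemma fpsP (R : Type) (A B : {fps R}) : A =1 B <-> A = B.
Proof.
split=> [|-> //]; case: A B => [a] [b] /= ab.
by congr FPS; apply/funext.
Qed.

HB.instance Definition _ (R : Type) := gen_eqMixin {fps R}.
HB.instance Definition _ (R : Type) := gen_choiceMixin {fps R}.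

Section FpsZmodule.
Variable R : zmodType.
Implicit Types A B : {fps R}.

Definition fps_zero : {fps R} := FPS (fun=> 0).
Definition fps_opp A : {fps R} := FPS (fun n => - A n).
Definition fps_add A B : {fps R} := FPS (fun n => A n + B n).

Fact fps_addA : associative fps_add.
Proof. by move=> A B C; apply/fpsP => n /=; rewrite addrA. Qed.
Fact fps_addC : commutative fps_add.
Proof. by move=> A B; apply/fpsP => n /=; rewrite addrC. Qed.
Fact fps_add0 : left_id fps_zero fps_add.
Proof. by move=> A; apply/fpsP => n /=; rewrite add0r. Qed.
Fact fps_addN : left_inverse fps_zero fps_opp fps_add.
Proof. by move=> A; apply/fpsP => n /=; rewrite addNr. Qed.

HB.instance Definition _ := GRing.isZmodule.Build {fps R}
  fps_addA fps_addC fps_add0 fps_addN.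

End FpsZmodule.

Section FpsRing.
Variable R : comNzRingType.
Implicit Types A B C : {fps R}.

Definition fps_one : {fps R} := FPS (fun n => (n == 0%N)%:R).
Definition fps_mul A B : {fps R} :=
  FPS (fun n => \sum_(i < n.+1) A i * B (n - i)%N).
Definition fps_scale (c : R) A : {fps R} := FPS (fun n => c * A n).

Definition fps_trunc (n : nat) A : {poly R} := \poly_(i < n.+1) A i.

Lemma coef_fps_trunc n A i : (i <= n)%N -> (fps_trunc n A)`_i = A i.
Proof. by move=> le_in; rewrite coef_poly ltnS le_in. Qed.

Lemma coef_truncM n A B (p q : {poly R}) :
    (forall i, (i <= n)%N -> p`_i = A i) ->
    (forall i, (i <= n)%N -> q`_i = B i) ->
  forall i, (i <= n)%N -> (p * q)`_i = fps_mul A B i.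
Proof.
move=> pA qB i le_in; rewrite coefM; apply: eq_bigr => j _.
rewrite pA ?qB //; first by rewrite (leq_trans (leq_subr _ _)).
by rewrite (leq_trans _ le_in) // -ltnS.
Qed.

Fact fps_mulA : associative fps_mul.
Proof.
move=> A B C; apply/fpsP => n; pose T := fps_trunc n.
have TE X i : (i <= n)%N -> (T X)`_i = X i by apply: coef_fps_trunc.
rewrite -(coef_truncM (TE A) (coef_truncM (TE B) (TE C))) //.
by rewrite mulrA (coef_truncM (coef_truncM (TE A) (TE B)) (TE C)).
Qed.

Fact fps_mulC : commutative fps_mul.
Proof.
move=> A B; apply/fpsP => n; pose T := fps_trunc n.
have TE X i : (i <= n)%N -> (T X)`_i = X i by apply: coef_fps_trunc.
by rewrite -(coef_truncM (TE A) (TE B)) // mulrC (coef_truncM (TE B) (TE A)).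
Qed.

Fact fps_mul1 : left_id fps_one fps_mul.
Proof.
move=> A; apply/fpsP => n /=; rewrite big_ord_recl /= mul1r subn0.
by rewrite big1 ?addr0 // => i _; rewrite mul0r.
Qed.

Fact fps_mulDl : left_distributive fps_mul +%R.
Proof.
move=> A B C; apply/fpsP => n /=; rewrite -big_split /=.
by apply: eq_bigr => i _; rewrite mulrDl.
Qed.

Fact fps_one_neq0 : fps_one != 0.
Proof.
apply/eqP => /fpsP/(_ 0%N) /= /eqP.
by rewrite oner_eq0.
Qed.

HB.instance Definition _ := GRing.Zmodule_isComNzRing.Build {fps R}
  fps_mulA fps_mulC fps_mul1 fps_mulDl fps_one_neq0.

Fact fps_scaleA a b A : fps_scale a (fps_scale b A) = fps_scale (a * b) A.
Proof. by apply/fpsP => n /=; rewrite mulrA. Qed.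
Fact fps_scale1 : left_id 1 fps_scale.
Proof. by move=> A; apply/fpsP => n /=; rewrite mul1r. Qed.
Fact fps_scaleDr : right_distributive fps_scale +%R.
Proof. by move=> a A B; apply/fpsP => n /=; rewrite mulrDr. Qed.
Fact fps_scaleDl A : {morph fps_scale^~ A : a b / a + b}.
Proof. by move=> a b; apply/fpsP => n /=; rewrite mulrDl. Qed.

HB.instance Definition _ := GRing.Zmodule_isLmodule.Build R {fps R}
  fps_scaleA fps_scale1 fps_scaleDr fps_scaleDl.

Fact fps_scaleAl (a : R) A B : a *: (A * B) = (a *: A) * B.
Proof.
apply/fpsP => n /=; rewrite mulr_sumr.
by apply: eq_bigr => i _; rewrite mulrA.
Qed.

HB.instance Definition _ := GRing.Lmodule_isLalgebra.Build R {fps R}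
  fps_scaleAl.
HB.instance Definition _ := GRing.Lalgebra_isComAlgebra.Build R {fps R}.

Lemma coef_fpsM A B n : (A * B) n = \sum_(i < n.+1) A i * B (n - i)%N.
Proof. by []. Qed.

Definition fpsX : {fps R} := FPS (fun n => (n == 1%N)%:R).

(* A(B(x)) = \sum_k A_k B(x)^k, for B with zero constant term: then x^k divides
   B^k, so only the terms k <= n contribute to the coefficient of x^n.  The
   value is meaningless when B 0 != 0. *)
Definition fps_comp A B : {fps R} :=
  FPS (fun n => \sum_(k < n.+1) A k * (B ^+ k) n).

Definition is_compositional_inverse A B : Prop :=
  [/\ A 0%N = 0, A 1%N != 0, B 0%N = 0, fps_comp A B = fpsX & fps_comp B A = fpsX].

(* A(x) = x + ... *)
Definition x_plus_higher A : Prop := A 0%N = 0 /\ A 1%N = 1.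

End FpsRing.

Arguments fpsX {R}.

(* Main.v *)
(* Both parts solve a system of equations that is triangular in the unknown
   coefficients.  For the root, write A = x (1 + x G); the coefficient of
   x^(n+1) in (1 + x G)^r is r G_n plus a term in G_0, ..., G_(n-1), and r is
   invertible in characteristic zero.  For the inverse, the coefficient of x^n
   in B(A(x)) is B_n plus a term in B_0, ..., B_(n-1), so A has a unique left
   inverse B.  It is also a right inverse: (A o B) o A = A o (B o A) = A = x o A,
   and right composition with A is injective by triangularity. *)
Require Import Defs.
From mathcomp Require Import all_boot all_algebra.

Import GRing.Theory.
Local Open Scope ring_scope.

Section Triangular.
Variables (F : fieldType) (Phi : {fps F} -> {fps F}) (c : nat -> F).
Hypothesis c_neq0 : forall n, c n != 0.
(** Triangularity: the n-th coefficient of [Phi G] is [c n * G n] plus a quantity fixed by the lower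
    coefficients of [G]. Taking differences avoids naming that quantity. *)
Hypothesis PhiB : forall n (G H : {fps F}),
  (forall i, (i < n)%N -> G i = H i) -> Phi G n - Phi H n = c n * (G n - H n).

Lemma triangular_inj : injective Phi.
Proof.
move=> G H eqGH; apply/fpsP => n; elim/ltn_ind: n => n IHn.
have /esym/eqP := PhiB n G H IHn.
by rewrite eqGH subrr mulf_eq0 (negPf (c_neq0 n)) subr_eq0 => /eqP.
Qed.

Lemma triangular_surj (T : {fps F}) : exists G, Phi G = T.
Proof.
(* Adjusts coefficient n alone, by the current error in degree n divided by [c n]. *)
pose step n (S : {fps F}) : {fps F} :=
  FPS (fun i => if i == n then S n + (T n - Phi S n) / c n else S i).
pose s := fix s n := if n is m.+1 then step m (s m) else 0 : {fps F}.
(* Coefficient i is final from stage i+1 on, so the stages have a diagonal limit [G]. *)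
have s_stable n i : (i < n)%N -> s n i = s i.+1 i.
  elim: n => // n IHn; rewrite ltnS leq_eqVlt => /predU1P[-> //|lt_in].
  by rewrite -IHn //= ltn_eqF.
pose G : {fps F} := FPS (fun i => s i.+1 i).
exists G; apply/fpsP => n.
have /(PhiB n G (s n)) : forall i, (i < n)%N -> G i = s n i.
  by move=> i lt_in; rewrite s_stable.
rewrite /= eqxx addrAC subrr add0r mulrC divfK //.
by move/addIr.
Qed.

End Triangular.

Section PowerSeries.
Variable R : comNzRingType.
Implicit Types (A B C : {fps R}) (p : {poly R}).

Lemma coef_fps_sum (I : Type) (s : seq I) (P : pred I) (f : I -> {fps R}) n :
  (\sum_(i <- s | P i) f i) n = \sum_(i <- s | P i) f i n.
Proof. by apply: (big_morph (fun A : {fps R} => A n)). Qed.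

Lemma coef_fps_affine (c d : R) A n :
  (c%:A + d *: A) n = c * (n == 0%N)%:R + d * A n.
Proof. by []. Qed.

Lemma coef0_fpsM A B : (A * B) 0%N = A 0%N * B 0%N.
Proof. by rewrite coef_fpsM big_ord1. Qed.

Lemma coef0_fpsX A k : (A ^+ k) 0%N = A 0%N ^+ k.
Proof. by elim: k => // k IHk; rewrite !exprS coef0_fpsM IHk. Qed.

Lemma coef_fpsXM A n : (fpsX * A) n = if n is m.+1 then A m else 0.
Proof.
rewrite coef_fpsM big_ord_recl /= mul0r add0r.
case: n => [|n]; first by rewrite big_ord0.
rewrite big_ord_recl /= mul1r subSS subn0 big1 ?addr0 // => i _.
by rewrite /= mul0r.
Qed.

Lemma coef_fpsXnM A k n :
  (fpsX ^+ k * A) n = if (n < k)%N then 0 else A (n - k)%N.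
Proof.
elim: k n => [|k IHk] n; first by rewrite mul1r subn0.
by rewrite exprS -mulrA coef_fpsXM; case: n.
Qed.

Lemma fpsX_factor A : A 0%N = 0 -> A = fpsX * FPS (fun n => A n.+1).
Proof. by move=> A0; apply/fpsP => -[|n]; rewrite coef_fpsXM. Qed.

Lemma coef_fps_exp_low A k n : A 0%N = 0 -> (n < k)%N -> (A ^+ k) n = 0.
Proof.
by move=> /fpsX_factor -> lt_nk; rewrite exprMn coef_fpsXnM lt_nk.
Qed.

Lemma coef_fps_exp_diag A n : A 0%N = 0 -> (A ^+ n) n = A 1%N ^+ n.
Proof.
move=> A0; rewrite [in LHS](fpsX_factor A) // exprMn coef_fpsXnM.
by rewrite ltnn subnn coef0_fpsX.
Qed.

Lemma coef_fpsM_low A B n :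
  (forall i, (i < n)%N -> A i = 0) -> (A * B) n = A n * B 0%N.
Proof.
move=> A_low; rewrite coef_fpsM big_ord_recr /= subnn.
by rewrite big1 ?add0r // => i _; rewrite A_low ?mul0r.
Qed.

(** Reduces each coefficient of a composition to polynomial evaluation, whose multiplicativity is
    then inherited by [fps_comp]. *)
Lemma fps_comp_horner A B p n :
    B 0%N = 0 -> (forall i, (i <= n)%N -> p`_i = A i) ->
  fps_comp A B n = horner_alg B p n.
Proof.
move=> B0 pA; rewrite /horner_alg /horner_morph.
(* This width covers both [size p] and the n+1 terms of [fps_comp]; the terms past n vanish because
   x^i divides [B ^+ i]. *)
rewrite (@horner_coef_wide _ (n.+1 + size p)); last first.
  by rewrite (leq_trans (size_poly _ _)) ?leq_addl.
have coef_term i :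
    ((map_poly (in_alg {fps R}) p)`_i * B ^+ i) n = p`_i * (B ^+ i) n.
  rewrite coef_map; exact: (congr1 (fun A : {fps R} => A n) (mulr_algl _ _)).
rewrite coef_fps_sum.
rewrite (eq_bigr (fun i : 'I_(_ + _) => p`_i * (B ^+ i) n)); last first.
  by move=> i _; apply: coef_term.
rewrite big_split_ord /= [X in _ + X]big1 ?addr0 => [|i _].
  by apply: eq_bigr => i _; rewrite pA // -ltnS.
by rewrite coef_fps_exp_low ?mulr0 // ltnS leq_addr.
Qed.

Lemma fps_compM A B C :
  C 0%N = 0 -> fps_comp (A * B) C = fps_comp A C * fps_comp B C.
Proof.
move=> C0; apply/fpsP => n; pose T := @fps_trunc R n.
have TE X i : (i <= n)%N -> (T X)`_i = X i by apply: coef_fps_trunc.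
have compE X i : (i <= n)%N -> fps_comp X C i = horner_alg C (T X) i.
  move=> le_in; apply: fps_comp_horner => // j le_ji.
  by rewrite TE ?(leq_trans le_ji).
(* [T A * T B] need not be the truncation of [A * B], but agrees with it up to degree n. *)
rewrite (fps_comp_horner _ _ (T A * T B)) //; last first.
  by move=> i; apply: coef_truncM => //; apply: TE.
rewrite rmorphM !coef_fpsM; apply: eq_bigr => i _.
by rewrite -!compE ?leq_subr // -ltnS.
Qed.

Lemma fps_comp1 C : fps_comp 1 C = 1.
Proof.
apply/fpsP => n /=; rewrite big_ord_recl /= mul1r big1 ?addr0 // => i _.
by rewrite mul0r.
Qed.

Lemma fps_compX A B k : B 0%N = 0 -> fps_comp (A ^+ k) B = fps_comp A B ^+ k.
Proof.
by move=> B0; elim: k => [|k IHk]; rewrite ?fps_comp1 // !exprS fps_compM ?IHk.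
Qed.

Lemma fps_comp_fpsXr A : fps_comp A fpsX = A.
Proof.
apply/fpsP => n /=; rewrite big_ord_recr /= big1 ?add0r => [|i _].
  by rewrite coef_fps_exp_diag //= expr1n mulr1.
rewrite -[fpsX ^+ i]mulr1 coef_fpsXnM ltnNge ltnW //=.
by rewrite subn_eq0 leqNgt ltn_ord mulr0.
Qed.

Lemma fps_comp_fpsXl A : A 0%N = 0 -> fps_comp fpsX A = A.
Proof.
move=> A0; apply/fpsP => -[|n] /=; first by rewrite big_ord1 mul0r A0.
rewrite big_ord_recl big_ord_recl /= mul0r add0r mul1r big1 ?addr0 // => i _.
by rewrite mul0r.
Qed.

Lemma fps_compA A B C : B 0%N = 0 -> C 0%N = 0 ->
  fps_comp (fps_comp A B) C = fps_comp A (fps_comp B C).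
Proof.
move=> B0 C0; apply/fpsP => n /=.
under [RHS]eq_bigr => j _ do rewrite -fps_compX // /= mulr_sumr.
rewrite exchange_big /=; apply: eq_bigr => k _.
under [RHS]eq_bigr => j _ do rewrite mulrA.
rewrite -mulr_suml; congr (_ * _).
(* Both sides sum A_j (B^j)_k (C^k)_n; the ranges j <= k and j <= n give the same sum, as (B^j)_k =
   0 for j > k. *)
rewrite (big_ord_widen n.+1 (fun j => A j * (B ^+ j) k)) //.
rewrite big_mkcond /=; apply: eq_bigr => j _; case: ltnP => // lt_kj.
by rewrite coef_fps_exp_low ?mulr0.
Qed.

End PowerSeries.

Lemma fps_left_inverse (F : fieldType) (A : {fps F}) :
    A 0%N = 0 -> A 1%N != 0 ->
  injective (fun B => fps_comp B A) /\ exists B, fps_comp B A = fpsX.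
Proof.
(* The diagonal entry of [B] -> B(A(x)) is (A^n)_n = A_1^n. *)
move=> A0 A1; pose c n := A 1%N ^+ n.
have c_neq0 n : c n != 0 by rewrite expf_neq0.
have compB n (G H : {fps F}) : (forall i, (i < n)%N -> G i = H i) ->
    fps_comp G A n - fps_comp H A n = c n * (G n - H n).
  move=> eqGH /=; rewrite -sumrB big_ord_recr /= big1 ?add0r => [|i _].
    by rewrite -mulrBl coef_fps_exp_diag // mulrC.
  by rewrite eqGH ?subrr.
split; first exact: triangular_inj c_neq0 compB.
exact: triangular_surj c_neq0 compB _.
Qed.

Lemma fps_inverse (F : fieldType) (A : {fps F}) : x_plus_higher A ->
  exists B, unique (is_compositional_inverse A) B /\ x_plus_higher B.
Proof.
move=> [A0 A1]; have A1n0 : A 1%N != 0 by rewrite A1 oner_neq0.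
have [compA_inj [B BA]] := fps_left_inverse F A A0 A1n0; exists B.
have B0 : B 0%N = 0.
  by move/fpsP/(_ 0%N): BA; rewrite /= big_ord1 mulr1.
have B1 : B 1%N = 1.
  move/fpsP/(_ 1%N): BA.
  by rewrite /= !big_ord_recl big_ord0 B0 mul0r add0r addr0 A1 mulr1.
split=> //; split=> [|B' [_ _ _ _ B'A]]; last first.
  by apply: compA_inj; rewrite BA B'A.
split=> //; apply: compA_inj.
by rewrite fps_compA // BA fps_comp_fpsXr fps_comp_fpsXl.
Qed.

Lemma fps_root (F : fieldType) (r : nat) (T : {fps F}) :
    r%:R != 0 :> F -> T 0%N = 1 ->
  exists! G : {fps F}, (1 + fpsX * G) ^+ r = T.
Proof.
(* The shift by one is needed because G_n first appears in degree n+1. The dropped constant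
   coefficient is 1 on both sides. *)
move=> r_neq0 T0; pose Phi (G : {fps F}) : {fps F} :=
  FPS (fun n => ((1 + fpsX * G) ^+ r) n.+1).
have coef0 (G : {fps F}) : (1 + fpsX * G) 0%N = 1.
  by rewrite /= big_ord1 mul0r addr0.
have PhiB n (G H : {fps F}) : (forall i, (i < n)%N -> G i = H i) ->
    Phi G n - Phi H n = r%:R * (G n - H n).
  move=> eqGH; set U := 1 + fpsX * G; set V := 1 + fpsX * H.
  have ->: Phi G n - Phi H n = (U ^+ r - V ^+ r) n.+1 by [].
  (* The last factor is a sum of r terms with constant term 1, whence the diagonal entry r. *)
  have ->: U ^+ r - V ^+ r =
      fpsX * ((G - H) * \sum_(i < r) U ^+ (r.-1 - i) * V ^+ i).
    rewrite subrXX mulrA mulrBr; congr (_ * _).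
    by rewrite opprD addrACA subrr add0r.
  rewrite coef_fpsXM coef_fpsM_low => [|i lt_in]; last by rewrite /= eqGH ?subrr.
  rewrite coef_fps_sum (eq_bigr (fun=> 1)) => [|i _]; last first.
    by rewrite coef0_fpsM !coef0_fpsX !coef0 !expr1n mulr1.
  by rewrite sumr_const card_ord mulrC.
have PhiE G : Phi G = FPS (fun n => T n.+1) <-> (1 + fpsX * G) ^+ r = T.
  split=> [/fpsP PhiG|<-//]; apply/fpsP => -[|n]; last exact: PhiG.
  by rewrite coef0_fpsX coef0 expr1n T0.
have [G /PhiE PhiG] :=
  triangular_surj F Phi _ (fun=> r_neq0) PhiB (FPS (fun n => T n.+1)).
exists G; split=> // G' eqG'.
apply: (triangular_inj F Phi _ (fun=> r_neq0) PhiB).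
by rewrite ((PhiE _).2 eqG') ((PhiE _).2 PhiG).
Qed.

Theorem corollary2p3 (F : fieldType) (char0 : [pchar F] =i pred0)
    (a : {fps F}) (r : nat) (r_gt0 : (0 < r)%N) (ar_neq0 : a r != 0)
    (a_low : forall i : nat, (0 < i < r)%N -> a i = 0) :
  (exists! A : {fps F},
     x_plus_higher A /\ a = (a 0%N)%:A + a r *: A ^+ r) /\
  (forall A : {fps F},
     x_plus_higher A -> a = (a 0%N)%:A + a r *: A ^+ r ->
     exists B : {fps F},
       unique (is_compositional_inverse A) B /\ x_plus_higher B).
Proof.
split=> [|A A_x _]; last exact: fps_inverse.
have r_neq0 : r%:R != 0 :> F by rewrite pcharf0P in char0; rewrite char0 -lt0n.
(* T = (a - a_0) / (a_r x^r). Cancelling x^r turns the equation for A = x (1 + x G) into (1 + x G)^r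
   = T. *)
pose T : {fps F} := FPS (fun n => (a r)^-1 * a (n + r)%N).
have T0 : T 0%N = 1 by rewrite /= add0n mulVf.
have aE (G : {fps F}) :
    a = (a 0%N)%:A + a r *: (fpsX * (1 + fpsX * G)) ^+ r <->
    (1 + fpsX * G) ^+ r = T.
  rewrite exprMn; split=> [/fpsP aG | ->]; apply/fpsP => n.
    rewrite [RHS]/= [a (n + r)%N]aG coef_fps_affine coef_fpsXnM.
    rewrite ltnNge leq_addl addnK.
    by rewrite addn_eq0 andbC (gtn_eqF r_gt0) mulr0 add0r mulKf.
  rewrite coef_fps_affine coef_fpsXnM; case: ltnP => [lt_nr | le_rn].
    (* Below degree r only the constant a_0 survives, by [a_low]. *)
    rewrite mulr0 addr0; case: n lt_nr => [|n] lt_nr; first by rewrite mulr1.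
    by rewrite mulr0 a_low.
  rewrite /= subnK // mulrA mulfV // mul1r.
  by rewrite (gtn_eqF (leq_trans r_gt0 le_rn)) mulr0 add0r.
have [G [GT G_uniq]] := fps_root F r T r_neq0 T0.
exists (fpsX * (1 + fpsX * G)); split=> [|A [[A0 A1] aA]].
  split; last by apply/aE.
  by split; rewrite coef_fpsXM //= big_ord1 mul0r addr0.
(* Every series x + ... has the form x (1 + x G), so uniqueness of G yields uniqueness of A. *)
have Adef : A = fpsX * (1 + fpsX * FPS (fun n => A n.+2)).
  apply/fpsP => -[|[|n]]; rewrite coef_fpsXM //.
    by rewrite A1 /= big_ord1 mul0r addr0.
  by rewrite -[RHS]/(0 + (fpsX * _) n.+1) coef_fpsXM add0r.
rewrite Adef in aA *.
by rewrite (G_uniq _ ((aE _).1 aA)).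
Qed.
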